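(* Let $X$ be a vector space over $\mathbb K$ ($\mathbb K=\mathbb R$ or $\mathbb C$). Finite-dimensional convergence on $X$ is Hausdorff and complete. It is the strongest linear convergence on $X$. It agrees with the convergence $\mu_{\mathcal B}$ induced by the bornology $\mathcal B$ of all bounded subsets of finite-dimensional subspaces of $X$.
   Context: A convergence structure on a set $X$ specifies, for each $x\in X$, which filters on $X$ converge to $x$, so that: (i) the principal ultrafilter of $x$ converges to $x$; (ii) if $\mathcal F\to x$ and $\mathcal F\subseteq\mathcal G$ then $\mathcal G\to x$; (iii) if $\mathcal F\to x$ and $\mathcal G\to x$ then $\mathcal F\cap\mathcal G\to x$. A net $(x_\alpha)$ converges to $x$ iff its tail filter (generated by the sets $\{x_\alpha : \alpha\ge\alpha_0\}$) converges to $x$; every filter is the tail filter of some net, so a convergence structure is determined by its convergent nets. It is Hausdorff if every net has at most one limit. A structure $\lambda$ is stronger than $\eta$ if every net that $\lambda$-converges to $x$ also $\eta$-converges to $x$. A convergence structure on a vector space is linear if addition and scalar multiplication are jointly continuous (preserve convergence of nets). A net $(x_\alpha)_{\alpha\in A}$ is Cauchy if the double net $(x_\alpha-x_\beta)$ indexed by $A\times A$ converges to $0$; the structure is complete if every Cauchy net converges. Finite-dimensional convergence on $X$: $x_\alpha\to 0$ if a tail of $(x_\alpha)$ is contained in a finite-dimensional subspace of $X$ and converges to zero there in the usual (Euclidean) sense; $x_\alpha\to x$ if $x_\alpha-x\to 0$. A bornology on $X$ is a collection of subsets closed under taking subsets and finite unions and covering $X$; here $\mathcal B$ consists of all sets contained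 in some finite-dimensional subspace of $X$ and bounded there in the usual sense. The induced bornological convergence $\mu_{\mathcal B}$: $x_\alpha\to 0$ if there exists $A\in\mathcal B$ such that for every $\varepsilon>0$ the set $\varepsilon A$ contains a tail of the net; $x_\alpha\to x$ if $x_\alpha-x\to 0$. *)

(* Defs.v *)
From HB Require Import structures.
From mathcomp Require Import all_boot all_order all_algebra complex.
From mathcomp Require Import all_classical all_reals topology normedtype.

Set Implicit Arguments.
Unset Strict Implicit.
Unset Printing Implicit Defensive.

Import Order.TTheory GRing.Theory Num.Theory.
Import numFieldNormedType.Exports.

Local Open Scope classical_set_scope.
Local Open Scope ring_scope.

Variant real_or_complex := RealScalars | ComplexScalars.

Definition scalars (R : realType) (k : real_or_complex) : numFieldType :=
  match k with RealScalars => R | ComplexScalars => R[i] end.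

Record directedType := DirectedType {
  dir_sort :> Type;
  dir_le : dir_sort -> dir_sort -> Prop;
  dir_inhabited : inhabited dir_sort;
  dir_refl : forall a, dir_le a a;
  dir_trans : forall a b c, dir_le a b -> dir_le b c -> dir_le a c;
  dir_upper : forall a b, exists c, dir_le a c /\ dir_le b c }.

Definition tails (A : directedType) : set_system A :=
  filter_from [set: A] (fun a0 => [set a | dir_le a0 a]).

Arguments tails : clear implicits.

Section DirectedProd.
Variables A B : directedType.

Let le (p q : A * B) := dir_le p.1 q.1 /\ dir_le p.2 q.2.

Fact dir_prod_inhabited : inhabited (A * B).
Proof. by case: (dir_inhabited A) (dir_inhabited B) => a [b]; exists. Qed.

Fact dir_prod_refl p : le p p.
Proof. by split; apply: dir_refl. Qed.

Fact dir_prod_trans p q r : le p q -> le q r -> le p r.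
Proof.
by move=> [pq1 pq2] [qr1 qr2]; split; [apply: dir_trans qr1|apply: dir_trans qr2].
Qed.

Fact dir_prod_upper p q : exists r, le p r /\ le q r.
Proof.
have [a [pa qa]] := dir_upper p.1 q.1; have [b [pb qb]] := dir_upper p.2 q.2.
by exists (a, b).
Qed.

Definition dir_prod : directedType :=
  DirectedType dir_prod_inhabited dir_prod_refl dir_prod_trans dir_prod_upper.

End DirectedProd.

(* [lam F x] reads "the filter F converges to x". *)
Definition convergence (X : Type) := set_system X -> X -> Prop.

(* Filters are proper; [cs_proper] makes structures with the same convergent
   filters equal, since [set_system X] also contains non-filters. *)
Record convergence_structure (X : Type) (lam : convergence X) : Prop := {
  cs_proper : forall F x, lam F x -> ProperFilter F;
  cs_principal : forall x, lam (principal_filter x) x;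
  cs_finer : forall F G x, ProperFilter G -> F `<=` G -> lam F x -> lam G x;
  cs_meet : forall F G x, lam F x -> lam G x -> lam (F `&` G) x }.

(* [u @ tails A] is the filter generated by the tails of the net u. *)
Definition net_cvg (X : Type) (lam : convergence X) (A : directedType)
  (u : A -> X) (x : X) : Prop := lam (u @ tails A) x.

Definition hausdorff_conv (X : Type) (lam : convergence X) : Prop :=
  forall (A : directedType) (u : A -> X) (x y : X),
    net_cvg lam u x -> net_cvg lam u y -> x = y.

Definition stronger (X : Type) (lam eta : convergence X) : Prop :=
  forall (A : directedType) (u : A -> X) (x : X),
    net_cvg lam u x -> net_cvg eta u x.

Section VectorSpace.
Variables (K : numFieldType) (X : lmodType K).
Implicit Types (lam : convergence X) (F : set_system X).

Record linear_convergence lam : Prop := {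
  lin_structure : convergence_structure lam;
  lin_add : forall (A : directedType) (u v : A -> X) (x y : X),
    net_cvg lam u x -> net_cvg lam v y ->
    net_cvg lam (fun a => u a + v a) (x + y);
  lin_scale : forall (A : directedType) (c : A -> K) (u : A -> X) (k : K) (x : X),
    c @ tails A --> k -> net_cvg lam u x ->
    net_cvg lam (fun a => c a *: u a) (k *: x) }.

Definition cauchy_net lam (A : directedType) (u : A -> X) : Prop :=
  net_cvg lam (fun p : dir_prod A A => u p.1 - u p.2) 0.

Definition complete_conv lam : Prop :=
  forall (A : directedType) (u : A -> X),
    cauchy_net lam u -> exists x, net_cvg lam u x.

Definition translated (conv0 : set_system X -> Prop) : convergence X :=
  fun F x => ProperFilter F /\ conv0 ((fun y => y - x) @ F).

(* A finite-dimensional subspace is the range of an injective linear map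
   f : K^n -> X, i.e. the span of the basis given by the images of the unit
   vectors; its usual topology and bounded sets are those of K^n carried over
   by f, and do not depend on f. *)
Definition findim_conv0 F : Prop :=
  exists (n : nat) (f : {linear 'rV[K]_n -> X}),
    [/\ injective f, F (range f) &
        forall V : set 'rV[K]_n, nbhs (0 : 'rV[K]_n) V -> F (f @` V)].

Definition findim_conv : convergence X := translated findim_conv0.

Record bornology (B : set (set X)) : Prop := {
  born_sub : forall S T, S `<=` T -> B T -> B S;
  born_union : forall S T, B S -> B T -> B (S `|` T);
  born_cover : \bigcup_(S in B) S = [set: X] }.

Definition findim_bounded : set (set X) := [set S |
  exists (n : nat) (f : {linear 'rV[K]_n -> X}),
    [/\ injective f, S `<=` range f & bounded_set (f @^-1` S)]].

(* In the partial order of a numFieldType, [0 < e] forces e to be real, also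
   when K is the field of complex numbers. *)
Definition born_conv0 (B : set (set X)) F : Prop :=
  exists2 S, B S & forall e : K, 0 < e -> F ((fun y => e *: y) @` S).

Definition born_conv (B : set (set X)) : convergence X :=
  translated (born_conv0 B).

End VectorSpace.

Arguments findim_conv {K} X.
Arguments findim_bounded {K} X.

(* Main.v *)
From HB Require Import structures.
Require Import Defs.
From mathcomp Require Import all_boot all_order all_algebra complex.
From mathcomp Require Import all_classical all_reals topology normedtype.
From mathcomp Require Import interval_inference.

(** A filter vanishes for finite-dimensional convergence when some linear
    injection [f : K^n -> X] pulls it back to a filter tending to [0]. The
    injectivity of [f] is a nuisance as soon as two filters are combined, since
    the sum [K^n * K^m -> X] of two injections may fail to be one. It can be
    dropped: any linear [f : K^n -> X] is an injective linear map preceded by a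
    matrix ([factor_injective]), and a matrix is a bounded operator
    ([mulmxr_bounded]). Hence convergence to [0] just says that, for some linear
    [f], the image under [f] of every ball around [0] belongs to the filter
    ([findim_conv0P]), and a set is in the bornology iff it lies in the image
    under some linear [f] of some ball ([findim_boundedP]).

    With these descriptions sums of maps give the stability of both notions
    under sums, intersections and unions, and the agreement with the
    bornological convergence is the homogeneity of the norm: the image of the
    unit ball witnesses the convergence of any vanishing filter.

    Injectivity is what one uses in the other direction, to lift a net lying
    eventually in the subspace to a net of coordinates in [K^n].
    - Hausdorff: by linearity it is enough that a vanishing constant net is
      zero, which holds because [K^n] is Hausdorff.
    - Complete: [u a - u b] eventually lies in one subspace, so from some
      [a0] on [u a - u a0] has coordinates in [K^n], they form a Cauchy net, and
      [K^n] is complete because [K] is.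
    - Strongest: if [u --> x] then eventually
      [u a = x + \sum_i w_i(a) *: e_i] with finitely many fixed vectors [e_i]
      and scalar nets [w_i --> 0], and any linear convergence sends such a net to
      [x]. *)

Set Implicit Arguments.
Unset Strict Implicit.
Unset Printing Implicit Defensive.

Import Order.TTheory GRing.Theory Num.Theory.
Import numFieldNormedType.Exports.

Local Open Scope classical_set_scope.
Local Open Scope ring_scope.

(** * The norm of row vectors *)

Lemma rV_nbhs0P (K : numFieldType) n (V : set 'rV[K]_n) :
  nbhs (0 : 'rV[K]_n) V <->
  exists2 e : K, 0 < e & forall w : 'rV[K]_n, `|w| < e -> V w.
Proof. exact: (@nbhs_norm0P K 'rV[K]_n V). Qed.

Section RowVectorNorm.
Variables (K : numFieldType) (n : nat).
Implicit Types w : 'rV[K]_n.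

(** Over a [numFieldType] such as the complex numbers the order is partial, so
    the norm is compared with a bound through a coordinate attaining it. *)
Lemma rV_norm_attained w : w = 0 \/ exists j, `|w| = `|w 0 j|.
Proof.
have [/eqP|w0] := eqVneq `|w| 0; first by rewrite normr_eq0 => /eqP; left.
by right; have [[i j] /= wE] := mx_norm_neq0 w0; exists j; rewrite -(ord1 i).
Qed.

Lemma rV_norm_ge w j : `|w 0 j| <= `|w|.
Proof.
rewrite [leRHS]mx_normE -[leLHS]nngE num_le.
exact: (le_bigmax _ (fun ij : 'I_1 * 'I_n => `|w ij.1 ij.2|%:nng) (0, j)).
Qed.

Lemma rV_norm_le w M : 0 <= M -> (forall j, `|w 0 j| <= M) -> `|w| <= M.
Proof.
by move=> M0 wM; have [->|[j ->]] := rV_norm_attained w; rewrite ?normr0.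
Qed.

Lemma rV_norm_lt w M : 0 < M -> (forall j, `|w 0 j| < M) -> `|w| < M.
Proof.
by move=> M0 wM; have [->|[j ->]] := rV_norm_attained w; rewrite ?normr0.
Qed.

End RowVectorNorm.

Section RowVectorMaps.
Variable K : numFieldType.

Lemma row_mx_coord n m (w1 : 'rV[K]_n) (w2 : 'rV[K]_m) (P : K -> Prop) :
  (forall j, P (w1 0 j)) -> (forall j, P (w2 0 j)) ->
  forall j, P (row_mx w1 w2 0 j).
Proof. by move=> P1 P2 j; rewrite mxE; case: (fintype.split j). Qed.

Lemma row_mx_norm_le n m (w1 : 'rV[K]_n) (w2 : 'rV[K]_m) M :
  `|w1| <= M -> `|w2| <= M -> `|row_mx w1 w2| <= M.
Proof.
move=> w1M w2M; apply: rV_norm_le; first exact: le_trans w1M.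
by apply: (row_mx_coord (P := fun c => `|c| <= M)) => j;
  apply: le_trans (rV_norm_ge _ _) _.
Qed.

Lemma row_mx_norm_lt n m (w1 : 'rV[K]_n) (w2 : 'rV[K]_m) M :
  `|w1| < M -> `|w2| < M -> `|row_mx w1 w2| < M.
Proof.
move=> w1M w2M; apply: rV_norm_lt; first exact: le_lt_trans w1M.
by apply: (row_mx_coord (P := fun c => `|c| < M)) => j;
  apply: le_lt_trans (rV_norm_ge _ _) _.
Qed.

Lemma mulmxr_bounded n r (P : 'M[K]_(n, r)) :
  exists2 C, 0 < C & forall w : 'rV[K]_n, `|w *m P| <= C * `|w|.
Proof.
pose S := \sum_i \sum_j `|P i j|.
have S0 : 0 <= S by apply: sumr_ge0 => i _; apply: sumr_ge0.
exists (1 + S); first by rewrite ltr_pwDl.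
move=> w; apply: rV_norm_le => [|j]; first by rewrite mulr_ge0 ?addr_ge0.
rewrite mxE (le_trans (ler_norm_sum _ _ _))// mulrC.
rewrite (@le_trans _ _ (`|w| * S))//; last first.
  by rewrite ler_wpM2l// lerDr.
rewrite mulr_sumr; apply: ler_sum => i _; rewrite normrM.
rewrite ler_pM ?rV_norm_ge// (bigD1 j)//= lerDl.
by apply: sumr_ge0.
Qed.

End RowVectorMaps.

(** * Linear maps from row vectors *)

Section LinearMaps.
Variables (K : numFieldType) (X : lmodType K).

(** A kernel vector with [v 0 j != 0] makes the [j]-th coordinate redundant:
    [w] may be replaced by [w - (w 0 j / v 0 j) *: v], whose [j]-th coordinate
    vanishes. *)
Lemma drop_coordinate n (f : {linear 'rV[K]_n -> X}) v :
  v != 0 -> f v = 0 ->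
  exists (g : {linear 'rV[K]_n.-1 -> X}) (P : 'M[K]_(n, n.-1)),
    (0 < n)%N /\ forall w, f w = g (w *m P).
Proof.
move=> v0 fv; have [j vj] : exists j, v 0 j != 0 by apply/rV0Pn.
(* [U] inserts a zero [j]-th coordinate, [Q] subtracts the multiple of [v]. *)
pose U : 'M[K]_(n.-1, n) := rowsub (lift j) 1%:M.
pose Q : 'M[K]_n := 1%:M - (v 0 j)^-1 *: (delta_mx j 0 *m v).
exists (f \o mulmxr U), (Q *m colsub (lift j) 1%:M).
split=> [|w /=]; first exact: leq_ltn_trans (ltn_ord j).
have wQ : w *m Q = w - (w 0 j / v 0 j) *: v.
  rewrite mulmxBr mulmx1 -scalemxAr mulmxA -colE; congr (_ - _).
  by apply/rowP => i; rewrite !mxE big_ord1 !mxE mulrA [_^-1 * _]mulrC.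
rewrite mulmxA wQ; set y := w - _.
have yj : y 0 j = 0 by rewrite !mxE divfK ?subrr.
suff -> : y *m colsub (lift j) 1%:M *m U = y.
  by rewrite /y linearB linearZ/= fv scaler0 subr0.
rewrite mulmx_colsub mulmx1; clearbody y.
apply/rowP => i; rewrite !mxE; case: (unliftP j i) => [i' ->|->].
  rewrite (bigD1 i')//= big1 ?addr0; last first.
    by move=> k ki; rewrite !mxE (inj_eq lift_inj) (negPf ki) mulr0.
  by rewrite !mxE eqxx mulr1.
rewrite yj big1// => k _; rewrite !mxE eq_sym (negPf (neq_lift _ _)).
by rewrite mulr0.
Qed.

(** Remove kernel vectors one coordinate at a time until none is left. *)
Lemma factor_injective n (f : {linear 'rV[K]_n -> X}) :
  exists (r : nat) (g : {linear 'rV[K]_r -> X}) (P : 'M[K]_(n, r)),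
    injective g /\ forall w, f w = g (w *m P).
Proof.
have [m] := ubnP n; elim: m n f => // m IH n f nm.
have [fI|] := pselect (forall v, f v = 0 -> v = 0).
  exists n, f, 1%:M; split; last by move=> w; rewrite mulmx1.
  by move=> v w /eqP; rewrite -subr_eq0 -linearB => /eqP/fI/subr0_eq.
move=> /existsNP[v /not_implyP[fv /eqP v0]].
have [g [P [n0 fg]]] := drop_coordinate v0 fv.
have [|r [h [Q [hI gh]]]] := IH _ g; first by rewrite prednK.
by exists r, h, (P *m Q); split=> // w; rewrite fg gh mulmxA.
Qed.

(** Puts two finite-dimensional subspaces into a common one. It need not be
    injective, even if [f] and [g] are. *)
Definition sum_map n m (f : {linear 'rV[K]_n -> X}) (g : {linear 'rV[K]_m -> X})
    (w : 'rV[K]_(n + m)) : X := f (lsubmx w) + g (rsubmx w).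

HB.instance Definition _ n m (f : {linear 'rV[K]_n -> X})
    (g : {linear 'rV[K]_m -> X}) :=
  GRing.Linear.copy (sum_map f g) ((f \o lsubmx) \+ (g \o rsubmx)).

Lemma sum_mapE n m (f : {linear 'rV[K]_n -> X}) (g : {linear 'rV[K]_m -> X})
  w1 w2 : sum_map f g (row_mx w1 w2) = f w1 + g w2.
Proof. by rewrite /sum_map row_mxKl row_mxKr. Qed.

Definition line (x : X) (w : 'rV[K]_1) : X := w 0 0 *: x.

Lemma line_is_linear x : linear (line x).
Proof. by move=> a u v; rewrite /line !mxE scalerDl scalerA. Qed.

HB.instance Definition _ x :=
  GRing.isLinear.Build K 'rV[K]_1 X *:%R (line x) (line_is_linear x).

Lemma lineE x (c : K) : line x (const_mx c) = c *: x.
Proof. by rewrite /line mxE. Qed.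

End LinearMaps.

(** * Finite-dimensional convergence and its bornology without injectivity *)

Section FinDim.
Variables (K : numFieldType) (X : lmodType K).
Implicit Types (F : set_system X).

(** Factor [f] as an injection after a matrix of operator norm at most [C]: the
    injection sends the [e]-ball onto a set containing the image under [f] of
    the [e / C]-ball. *)
Lemma findim_conv0P F : Filter F ->
  findim_conv0 F <-> exists n (f : {linear 'rV[K]_n -> X}),
    forall e : K, 0 < e -> F (f @` [set w | `|w| < e]).
Proof.
move=> FF; split=> [[n [f [fI Fr fV]]]|[n [f fe]]].
  exists n, f => e e0; apply: fV; by apply/rV_nbhs0P; exists e.
have [r [g [P [gI fg]]]] := factor_injective f.
have [C C0 PC] := mulmxr_bounded P.
have gV V : nbhs (0 : 'rV[K]_r) V -> F (g @` V).
  case/rV_nbhs0P=> e e0 eV.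
  apply: filterS (fe (e / C) (divr_gt0 e0 C0)) => _ [w /= we <-].
  exists (w *m P); last by rewrite fg.
  by apply: eV; rewrite (le_lt_trans (PC _))// mulrC -ltr_pdivlMr.
exists r, g; split=> //.
by apply: filterS (gV setT filterT) => _ [w _ <-]; exists w.
Qed.

Lemma findim_boundedP (S : set X) : findim_bounded X S <->
  exists n (f : {linear 'rV[K]_n -> X}) (M : K),
    0 <= M /\ S `<=` f @` [set w | `|w| <= M].
Proof.
split=> [[n [f [fI Sf [M [Mr SM]]]]]|[n [f [M [M0 SM]]]]].
  have M1 : M < `|M| + 1 by rewrite (le_lt_trans (real_ler_norm Mr))// ltrDl.
  exists n, f, (`|M| + 1); split; first by rewrite addr_ge0.
  move=> x Sx; have [w _ wx] := Sf _ Sx; exists w => //=.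
  by apply: (SM _ M1); rewrite /= wx.
have [r [g [P [gI fg]]]] := factor_injective f.
have [C C0 PC] := mulmxr_bounded P.
exists r, g; split=> //.
  by move=> x /SM[w _ <-]; exists (w *m P).
exists (C * M); split; first by rewrite ger0_real// mulr_ge0// ltW.
move=> N CN w /= /SM[v /= vM]; rewrite fg => /gI <-.
by rewrite (le_trans (PC _))// (le_trans _ (ltW CN))// ler_pM2l.
Qed.

Lemma meet_filter (F G : set_system X) :
  Filter F -> Filter G -> Filter (F `&` G).
Proof.
move=> FF FG; split; first by split; exact: filterT.
  by move=> A B [FA GA] [FB GB]; split; exact: filterI.
by move=> A B AB [FA GA]; split; exact: filterS AB _.
Qed.

Lemma findim_conv0_add T (G : set_system T) (u v : T -> X) : Filter G ->
  findim_conv0 (u @ G) -> findim_conv0 (v @ G) ->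
  findim_conv0 ((fun t => u t + v t) @ G).
Proof.
move=> FG /findim_conv0P[n [f uf]] /findim_conv0P[m [g vg]].
apply/findim_conv0P; exists _, (sum_map f g) => e e0.
apply: (@filterS2 _ G FG _ _ _ _ (uf e e0) (vg e e0)) => t /=.
move=> [w1 /= w1e <-] [w2 /= w2e <-].
by exists (row_mx w1 w2); [exact: row_mx_norm_lt | rewrite sum_mapE].
Qed.

Lemma findim_conv0_meet F G : Filter F -> Filter G ->
  findim_conv0 F -> findim_conv0 G -> findim_conv0 (F `&` G).
Proof.
move=> FF FG /findim_conv0P[n [f Ff]] /findim_conv0P[m [g Gg]].
have FFG := meet_filter FF FG.
apply/findim_conv0P; exists _, (sum_map f g) => e e0; split.
- apply: filterS (Ff e e0) => _ [w /= we <-].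
  exists (row_mx w 0); last by rewrite sum_mapE linear0 addr0.
  by apply: row_mx_norm_lt; rewrite ?normr0.
- apply: filterS (Gg e e0) => _ [w /= we <-].
  exists (row_mx 0 w); last by rewrite sum_mapE linear0 add0r.
  by apply: row_mx_norm_lt; rewrite ?normr0.
Qed.

Lemma findim_bounded_bornology : bornology (findim_bounded X).
Proof.
split.
- move=> S T ST /findim_boundedP[n [f [M [M0 TM]]]]; apply/findim_boundedP.
  by exists n, f, M; split=> //; exact: subset_trans TM.
- move=> S T /findim_boundedP[n [f [M [M0 SM]]]].
  move=> /findim_boundedP[m [g [N [N0 TN]]]]; apply/findim_boundedP.
  exists _, (sum_map f g), (M + N); split; first exact: addr_ge0.
  move=> x [/SM[w /= wM <-]|/TN[w /= wN <-]].
    exists (row_mx w 0); last by rewrite sum_mapE linear0 addr0.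
    apply: row_mx_norm_le; rewrite ?normr0 ?addr_ge0//.
    by rewrite (le_trans wM)// lerDl.
  exists (row_mx 0 w); last by rewrite sum_mapE linear0 add0r.
  apply: row_mx_norm_le; rewrite ?normr0 ?addr_ge0//.
  by rewrite (le_trans wN)// lerDr.
- apply/seteqP; split=> // x _; exists [set x] => //; apply/findim_boundedP.
  exists 1%N, (line x), 1; split=> // _ ->.
  exists (const_mx 1); last by rewrite /= lineE scale1r.
  by apply: rV_norm_le => // j; rewrite mxE normr1.
Qed.

(** Scaling by [e > 0] turns the unit ball into the [e]-ball, so the image of the
    unit ball witnesses bornological convergence. Conversely the ball of radius
    [M], scaled by [e / (M + 1)], fits into the open [e]-ball; adding [1] avoids
    dividing by [M = 0]. *)
Lemma findim_born_conv0 F : Filter F ->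
  findim_conv0 F <-> born_conv0 (findim_bounded X) F.
Proof.
move=> FF; rewrite findim_conv0P; split=> [[n [f Ff]]|].
  exists (f @` [set w | `|w| < 1]).
    apply/findim_boundedP; exists n, f, 1; split=> //.
    by apply: image_subset => w /ltW.
  move=> e e0; apply: filterS (Ff e e0) => _ [w /= we <-].
  exists (f (e^-1 *: w)).
    2: by rewrite linearZ scalerA divff ?gt_eqF// scale1r.
  exists (e^-1 *: w) => //=.
  by rewrite normrZ normfV gtr0_norm// mulrC ltr_pdivrMr// mul1r.
move=> [S /findim_boundedP[n [f [M [M0 SM]]]] Se].
exists n, f => e e0.
have M1 : 0 < M + 1 by rewrite ltr_wpDl.
apply: filterS (Se (e / (M + 1)) (divr_gt0 e0 M1)) => _ [_ /SM[w /= wM <-] <-].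
exists ((e / (M + 1)) *: w); last by rewrite linearZ.
rewrite /= normrZ gtr0_norm ?divr_gt0// mulrAC ltr_pdivrMr// ltr_pM2l//.
by rewrite (le_lt_trans wM)// ltrDl.
Qed.

End FinDim.

(** * Finite-dimensional convergence is linear and Hausdorff *)

Section Nets.
Variables (K : numFieldType) (X : lmodType K).

#[local] Instance tails_proper (A : directedType) : ProperFilter (tails A).
Proof.
apply: filter_from_proper; last by move=> a _; exists a; exact: dir_refl.
apply: filter_from_filter; first by case: (dir_inhabited A) => a; exists a.
move=> a b _ _; have [c [ac bc]] := dir_upper a b.
by exists c => // d /= cd; split; [exact: dir_trans ac cd|exact: dir_trans bc cd].
Qed.

Lemma net_findimE (A : directedType) (u : A -> X) x :
  net_cvg (findim_conv X) u x <-> findim_conv0 ((fun a => u a - x) @ tails A).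
Proof.
split; first by case.
by move=> h; split=> //; exact: fmap_proper_filter.
Qed.

Lemma findim_convergence_structure : convergence_structure (findim_conv X).
Proof.
split.
- by move=> F x [].
- move=> x; split; first exact: principal_filter_proper.
  apply/findim_conv0P; exists 1%N, (line 0) => e e0.
  apply/principal_filterP; exists 0; rewrite /= ?normr0//.
  by rewrite linear0 subrr.
- move=> F G x FG sFG [FF /findim_conv0P[n [f Ff]]]; split=> //.
  by apply/findim_conv0P; exists n, f => e e0; apply: sFG; exact: Ff.
- move=> F G x [FF Fx] [FG Gx]; split.
    split; first by case=> /filter_not_empty.
    exact: meet_filter.
  exact: (findim_conv0_meet _ _ Fx Gx).
Qed.

Lemma findim_conv0_line T (G : set_system T) (c : T -> K) (x : X) : Filter G ->
  c @ G --> 0 -> findim_conv0 ((fun t => c t *: x) @ G).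
Proof.
move=> FG c0; apply/findim_conv0P; exists 1%N, (line x) => e e0.
have /c0 ce : nbhs (0 : K^o) [set y | `|y| < e].
  by apply/(@nbhs_norm0P K K^o); exists e.
apply: (@filterS _ G FG _ _ _ ce) => t /= cte.
exists (const_mx (c t)); rewrite /= ?lineE//.
by apply: rV_norm_lt => // j; rewrite mxE.
Qed.

(** A convergent net of scalars is eventually bounded by [`|k| + 1]. *)
Lemma findim_conv0_scale T (G : set_system T) (c : T -> K) (k : K) (u : T -> X) :
  Filter G -> c @ G --> k ->
  findim_conv0 (u @ G) -> findim_conv0 ((fun t => c t *: u t) @ G).
Proof.
move=> FG ck /findim_conv0P[n [f uf]]; apply/findim_conv0P; exists n, f => e e0.
have k1 : 0 < `|k| + 1 by rewrite ltr_wpDl.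
have /ck ck1 : nbhs (k : K^o) [set y | `|y - k| < 1].
  by apply/(@nbhs_normP K K^o); exists 1 => //= y /=; rewrite distrC.
apply: (@filterS2 _ G FG _ _ _ _ ck1 (uf _ (divr_gt0 e0 k1))) => t /= ct1.
move=> [w /= we <-].
exists (c t *: w); last by rewrite linearZ.
rewrite /= normrZ; have [->|w0] := eqVneq w 0; first by rewrite normr0 mulr0.
rewrite (@lt_trans _ _ ((`|k| + 1) * `|w|))//.
  rewrite ltr_pM2r ?normr_gt0// -[c t](subrK k) addrC.
  by rewrite (le_lt_trans (ler_normD _ _))// ltrD2l.
by rewrite mulrC -ltr_pdivlMr.
Qed.

Lemma findim_linear : linear_convergence (findim_conv X).
Proof.
split; first exact: findim_convergence_structure.
- move=> A u v x y /net_findimE ux /net_findimE vy; apply/net_findimE.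
  under eq_fun do rewrite opprD addrACA.
  exact: findim_conv0_add.
- move=> A c u k x ck /net_findimE ux; apply/net_findimE.
  have -> : (fun a => c a *: u a - k *: x) =
            (fun a => c a *: (u a - x) + (c a - k) *: x).
    by apply/funext => a; rewrite scalerBr scalerBl addrA subrK.
  apply: findim_conv0_add; first exact: (findim_conv0_scale _ ck ux).
  apply: findim_conv0_line.
  by rewrite -(subrr k); apply: cvgB => //; exact: cvg_cst.
Qed.

(** If [x = f w] with [w != 0] then [f] maps the ball of radius [`|w|] to a set
    that misses [x], as [f] is injective. *)
Lemma findim_conv0_cst_eq0 T (G : set_system T) (x : X) : ProperFilter G ->
  findim_conv0 ((fun=> x) @ G) -> x = 0.
Proof.
move=> FG [n [f [fI _ fV]]].
have xV V : nbhs (0 : 'rV[K]_n) V -> (f @` V) x.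
  by move=> /fV/(@filter_ex _ G FG)[t].
have [w _ wx] := xV setT filterT.
have [w0|w0] := eqVneq w 0; first by rewrite -wx w0 linear0.
have /xV[v /=] : nbhs (0 : 'rV[K]_n) [set v | `|v| < `|w|].
  by apply/rV_nbhs0P; exists `|w|; rewrite // normr_gt0.
by rewrite -wx => + /fI vw; rewrite vw ltxx.
Qed.

Lemma findim_hausdorff : hausdorff_conv (findim_conv X).
Proof.
(* The difference of [u - y] and [u - x] is the constant net [x - y]. *)
move=> A u x y /net_findimE ux /net_findimE uy; apply/eqP; rewrite -subr_eq0.
have uyN := findim_conv0_scale _ (cvg_cst (-1 : K^o)) ux.
have := findim_conv0_add _ uy (uyN _ _).
under eq_fun do rewrite scaleN1r opprB addrC addrA subrK.
by move=> H; apply/eqP; exact: findim_conv0_cst_eq0 (H _ _ _).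
Qed.

(** * Completeness *)

(** Coordinates for a net that lies only eventually in the range of [f]; before
    that their values do not matter. *)
Lemma range_coordinates n (f : {linear 'rV[K]_n -> X}) T (u : T -> X) :
  exists w : T -> 'rV[K]_n, forall t, range f (u t) -> f (w t) = u t.
Proof.
exists (fun t => xget 0 [set v | f v = u t]) => t [v _ fv].
by apply: (@xgetPex _ 0 [set v | f v = u t]); exists v.
Qed.

Lemma findim_complete :
  (forall F : set_system K, ProperFilter F -> cauchy F -> cvg F) ->
  complete_conv (findim_conv X).
Proof.
move=> Kc A u /net_findimE.
under eq_fun do rewrite subr0.
case=> n [f [fI [[a1 b1] /= _ fr] fV]].
have [a0 [a10 b10]] := dir_upper a1 b1.
have [w wP] := range_coordinates f (fun a => u a - u a0).
have fw a : dir_le a0 a -> f (w a) = u a - u a0.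
  move=> a0a; apply: wP; apply: (fr (a, a0)).
  by split=> //; exact: dir_trans a10 a0a.
(* [mx_complete] expects completeness as a structure on the scalars. *)
pose KU : puniformType := K.
pose KC : completeType := HB.pack (K : Type) KU (Uniform_isComplete.Build K Kc).
have wC : cauchy (w @ tails A).
  apply: cauchy_exP => e e0.
  have [|[a b] /= _ ab] := fV [set v | `|v| < e].
    by apply/rV_nbhs0P; exists e.
  have [c [ac bc]] := dir_upper a b; have [d [cd a0d]] := dir_upper c a0.
  exists (w d), d => // t /= dt.
  have [|v /= ve fv] := ab (t, d).
    split=> /=; last exact: dir_trans bc cd.
    by apply: dir_trans dt; exact: dir_trans ac cd.
  rewrite mx_norm_ball /ball_ /= -opprB normrN.
  suff -> : w t - w d = v by [].
  apply: fI; rewrite fv linearB !fw ?opprB ?addrA ?subrK//.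
  exact: dir_trans a0d dt.
have /cvg_ex[l wl] : cvg (w @ tails A) by exact: (@mx_complete KC).
exists (u a0 + f l); apply/net_findimE/findim_conv0P.
exists n, f => e e0.
have /wl [a _ ae] : nbhs l [set v : 'rV[K]_n | `|v - l| < e].
  by apply/(@nbhs_normP K 'rV[K]_n); exists e => //= v /=; rewrite distrC.
have [b [ab a0b]] := dir_upper a a0.
exists b => // t /= bt; exists (w t - l).
  by apply: ae => /=; exact: dir_trans ab bt.
rewrite linearB fw; last exact: dir_trans a0b bt.
by rewrite opprD addrA.
Qed.

(** * Comparison with an arbitrary linear convergence *)

Section Strongest.
Variables (lam : convergence X) (lamL : linear_convergence lam).

Lemma net_cvg_cst (A : directedType) (x : X) :
  net_cvg lam (fun _ : A => x) x.
Proof.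
have [lamS _ _] := lamL.
apply: (cs_finer lamS) (cs_principal lamS x).
by move=> S /principal_filterP Sx; apply: (@filterE _ (tails A)).
Qed.

Lemma net_cvg_sum (A : directedType) n (c : A -> 'I_n -> K) (x : 'I_n -> X) :
  (forall i, (c ^~ i) @ tails A --> 0) ->
  net_cvg lam (fun a => \sum_i c a i *: x i) 0.
Proof.
move=> c0.
suff H (s : seq 'I_n) : net_cvg lam (fun a => \sum_(i <- s) c a i *: x i) 0.
  exact: H.
elim: s => [|i s IH].
  by under eq_fun do rewrite big_nil; exact: net_cvg_cst.
under eq_fun do rewrite big_cons.
rewrite -[X in net_cvg _ _ X]addr0; apply: (lin_add lamL _ IH).
rewrite -[X in net_cvg _ _ X](scale0r (x i)).
by apply: (lin_scale lamL _ (net_cvg_cst _ _)); exact: c0.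
Qed.

Lemma findim_strongest : stronger (findim_conv X) lam.
Proof.
move=> A u x /net_findimE[n [f [fI [a0 /= _ fr] fV]]].
have [w wP] := range_coordinates f (fun a => u a - x).
have fw a : dir_le a0 a -> f (w a) = u a - x by move=> /fr/wP.
have w0 i : (fun a => w a 0 i) @ tails A --> 0.
  move=> V /(@nbhs_norm0P K K^o)[e /= e0 eV].
  have [|a _ ae] := fV [set v | `|v| < e].
    by apply/rV_nbhs0P; exists e.
  have [b [ab a0b]] := dir_upper a a0.
  exists b => // t /= bt; apply: eV => /=.
  apply: le_lt_trans (rV_norm_ge _ _) _.
  have [v /= ve fv] := ae _ (dir_trans ab bt).
  by rewrite (fI (w t) v) // fw; last exact: dir_trans a0b bt.
have := lin_add lamL (net_cvg_cst A x)
  (net_cvg_sum (fun i => f (delta_mx 0 i)) w0).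
(* The two nets agree only eventually, but their tail filters are equal. *)
rewrite addr0; apply: (cs_finer (lin_structure lamL)).
move=> S [a _ aS]; have [b [ab a0b]] := dir_upper a a0.
exists b => // t /= bt.
have := aS t (dir_trans ab bt) => /=.
suff -> : \sum_i w t 0 i *: f (delta_mx 0 i) = u t - x by rewrite addrC subrK.
rewrite -fw; last exact: dir_trans a0b bt.
rewrite [in RHS](row_sum_delta (w t)) linear_sum.
by apply: eq_bigr => i _; rewrite linearZ.
Qed.

End Strongest.

End Nets.

(** * Completeness of the scalars *)

(** Over the complex numbers a Cauchy filter has Cauchy real and imaginary
    parts, because taking either part is 1-Lipschitz; the limits of the parts
    are the parts of the limit. *)
Lemma scalars_complete (R : realType) (k : real_or_complex)
    (F : set_system (scalars R k)) : ProperFilter F -> cauchy F -> cvg F.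
Proof.
case: k F => F; first exact: R_complete.
move=> FF /cauchyP Fc; set K := scalars R ComplexScalars in F FF Fc *.
have part_cvg (p : R[i] -> R) : (forall z y, `|p z - p y|%:C%C <= `|z - y|) ->
    exists a : R, forall e : R, 0 < e -> F [set z | `|p z - a| < e].
  move=> pl; have /(R_complete _)/cvg_ex[a pa] : cauchy (p @ F).
    apply: cauchy_exP => e e0.
    have [|z Fz] := Fc e%:C%C; first by rewrite ltcR.
    exists (p z); apply: (@filterS _ F _ _ _ _ Fz) => y /= zy.
    by rewrite /ball /= -ltcR (le_lt_trans (pl _ _)).
  exists a => e e0.
  have /pa : nbhs (a : R^o) [set y | `|y - a| < e].
    by apply/(@nbhs_normP R R^o); exists e => //= y /=; rewrite distrC.
  by [].
have [|a Fa] := part_cvg (@complex.Re R).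
  by move=> z y; rewrite -raddfB normc_ge_Re.
have [|b Fb] := part_cvg (@complex.Im R).
  move=> z y; rewrite -raddfB -normrN -ReiNIm (le_trans (normc_ge_Re _))//.
  by rewrite normrM complexiE normCi mulr1.
apply/cvg_ex; exists ((a +i* b)%C : K) => V.
case/(@nbhs_normP K K^o) => -[e e'] /=.
(* A positive complex number has a zero imaginary part. *)
rewrite ltcE => /andP[/= /eqP -> e0] eV.
have e2 : 0 < e / 2 by rewrite divr_gt0.
apply: (@filterS2 _ F _ _ _ _ _ (Fa _ e2) (Fb _ e2)) => -[x y] /= xa yb.
apply: eV => /=; rewrite distrC [_ - _]complexE /=.
rewrite (le_lt_trans (ler_normD _ _))// normrM complexiE normCi mul1r.
rewrite !normc_def /= expr0n /= addr0 !sqrtr_sqr.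
by rewrite -raddfD ltcR addr0 sqrtr_sqr [e]splitr ltrD.
Qed.

Theorem proposition7p12 (R : realType) (k : real_or_complex)
    (X : lmodType (scalars R k)) :
  [/\ hausdorff_conv (findim_conv X),
      complete_conv (findim_conv X),
      linear_convergence (findim_conv X) /\
        (forall lam : convergence X,
           linear_convergence lam -> stronger (findim_conv X) lam) &
      bornology (findim_bounded X) /\
        (forall (F : set_system X) (x : X),
           findim_conv X F x <-> born_conv (findim_bounded X) F x)].
Proof.
split.
- exact: findim_hausdorff.
- apply: findim_complete; exact: scalars_complete.
- split; first exact: findim_linear.
  by move=> lam; exact: findim_strongest.
- split; first exact: findim_bounded_bornology.
  by move=> F x; split=> -[FF /findim_born_conv0 Fx]; split.
Qed.
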